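(* Let $\mathcal{Z}\subseteq\mathbb{R}^n$ be a nonempty closed convex set and let $F:\mathbb{R}^n\to\mathbb{R}^n$ be a monotone and $L$-Lipschitz operator ($L>0$). Suppose $z^*\in\mathcal{Z}$ is a solution of the variational inequality, i.e. $\langle F(z^* ),z^*-z\rangle\le0$ for all $z\in\mathcal{Z}$. Let $\eta\in\left(0,\frac{1}{(1+\sqrt2)L}\right)$, let $z_{-1}=z_0\in\mathcal{Z}$, and for $t=0,1,2,\dots$ define $$z_{t+\frac12}=2z_t-z_{t-1},\qquad z_{t+1}=\Pi_{\mathcal{Z}}\big[z_t-\eta F(z_{t+\frac12})\big]$$ (the Reflected Gradient algorithm). Then for every integer $T\ge1$ and every $D>0$, $$r^{tan}_{F,\mathcal{Z}}(z_T)\le\frac{\lambda HL}{\sqrt T},\qquad \mathrm{Gap}_{\mathcal{Z},F,D}(z_T)\le\frac{\lambda DHL}{\sqrt T},$$ where $H^2=4\|z_0-z^*\|^2+\frac{13}{L^2}\|F(z_0)\|^2$ and $\lambda=\sqrt{\frac{6(1+3\eta^2L^2)}{\eta^2L^2\left(1-(1+\sqrt2)\eta L\right)}}$.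
   Context: $\|\cdot\|$ is the $\ell_2$-norm on $\mathbb{R}^n$. $F$ is monotone if $\langle F(z)-F(z'),z-z'\rangle\ge0$ for all $z,z'\in\mathbb{R}^n$. $\Pi_{\mathcal{Z}}$ is the Euclidean projection onto $\mathcal{Z}$. The normal cone of $\mathcal{Z}$ at $z\in\mathcal{Z}$ is $N_{\mathcal{Z}}(z)=\{a\in\mathbb{R}^n:\langle a,z'-z\rangle\le0\ \forall z'\in\mathcal{Z}\}$. The tangent residual is $r^{tan}_{F,\mathcal{Z}}(z)=\min_{c\in N_{\mathcal{Z}}(z)}\|F(z)+c\|$ for $z\in\mathcal{Z}$. The (restricted) gap function is $\mathrm{Gap}_{\mathcal{Z},F,D}(z)=\max_{z'\in\mathcal{Z}\cap\mathcal{B}(z,D)}\langle F(z),z-z'\rangle$, where $\mathcal{B}(z,D)$ is the closed Euclidean ball centered at $z$ with radius $D$. *)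

(* Defs.v *)
From mathcomp Require Import all_boot all_order all_algebra.
From mathcomp Require Import all_classical all_reals all_analysis.

Set Implicit Arguments.
Unset Strict Implicit.
Unset Printing Implicit Defensive.

Import Order.TTheory GRing.Theory Num.Theory.
Import numFieldNormedType.Exports.

Local Open Scope classical_set_scope.
Local Open Scope ring_scope.

Definition dotv (R : realType) (n : nat) (u v : 'rV[R]_n) : R :=
  \sum_(i < n) u 0 i * v 0 i.

(* The library norm on matrices is the sup norm, hence a separate l2-norm;
   both induce the same topology on ['rV[R]_n]. *)
Definition l2norm (R : realType) (n : nat) (u : 'rV[R]_n) : R :=
  Num.sqrt (dotv u u).

Definition monotone_operator (R : realType) (n : nat)
    (F : 'rV[R]_n -> 'rV[R]_n) : Prop :=
  forall z z', 0 <= dotv (F z - F z') (z - z').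

Definition l2_lipschitz (R : realType) (n : nat) (L : R)
    (F : 'rV[R]_n -> 'rV[R]_n) : Prop :=
  forall z z', l2norm (F z - F z') <= L * l2norm (z - z').

Definition VI_solution (R : realType) (n : nat) (Z : set 'rV[R]_n)
    (F : 'rV[R]_n -> 'rV[R]_n) (zs : 'rV[R]_n) : Prop :=
  Z zs /\ forall z, Z z -> dotv (F zs) (zs - z) <= 0.

(* A minimizer exists and is unique when [Z] is nonempty, closed and convex;
   otherwise [xget] may return the dummy value [x]. *)
Definition eproj (R : realType) (n : nat) (Z : set 'rV[R]_n) (x : 'rV[R]_n) :
    'rV[R]_n :=
  xget x [set p | Z p /\ forall z, Z z -> l2norm (x - p) <= l2norm (x - z)].

Definition normal_cone (R : realType) (n : nat) (Z : set 'rV[R]_n)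
    (z : 'rV[R]_n) : set 'rV[R]_n :=
  [set a | forall z', Z z' -> dotv a (z' - z) <= 0].

(* The infimum is over a set bounded below by 0 and nonempty ([c = 0]); it is
   a minimum because the normal cone is closed. *)
Definition tangent_residual (R : realType) (n : nat)
    (F : 'rV[R]_n -> 'rV[R]_n) (Z : set 'rV[R]_n) (z : 'rV[R]_n) : R :=
  inf [set l2norm (F z + c) | c in normal_cone Z z].

Definition l2_closed_ball (R : realType) (n : nat) (z : 'rV[R]_n) (D : R) :
    set 'rV[R]_n :=
  [set z' | l2norm (z' - z) <= D].

(* For [Z z] and [0 <= D] the supremum is over a set containing 0 ([z' = z])
   and bounded above by [l2norm (F z) * D]; it is a maximum when [Z] is closed,
   by compactness. *)
Definition gap (R : realType) (n : nat) (Z : set 'rV[R]_n)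
    (F : 'rV[R]_n -> 'rV[R]_n) (D : R) (z : 'rV[R]_n) : R :=
  sup [set dotv (F z) (z - z') | z' in Z `&` l2_closed_ball z D].

(* The state is the pair (z_{t-1}, z_t), started at (z_{-1}, z_0) = (z0, z0). *)
Definition rg_step (R : realType) (n : nat) (Z : set 'rV[R]_n)
    (F : 'rV[R]_n -> 'rV[R]_n) (eta : R) (s : 'rV[R]_n * 'rV[R]_n) :
    'rV[R]_n * 'rV[R]_n :=
  let zhalf := 2 *: s.2 - s.1 in
  (s.2, eproj Z (s.2 - eta *: F zhalf)).

Definition reflected_gradient (R : realType) (n : nat) (Z : set 'rV[R]_n)
    (F : 'rV[R]_n -> 'rV[R]_n) (eta : R) (z0 : 'rV[R]_n) (t : nat) :
    'rV[R]_n :=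
  (iter t (rg_step Z F eta) (z0, z0)).2.

(* Main.v *)
Require Import Defs.
From mathcomp Require Import all_boot all_order all_algebra.
From mathcomp Require Import all_classical all_reals all_analysis.
From mathcomp Require Import ring lra.

Set Implicit Arguments.
Unset Strict Implicit.
Unset Printing Implicit Defensive.

Import Order.TTheory GRing.Theory Num.Theory.
Import numFieldNormedType.Exports.

Local Open Scope classical_set_scope.
Local Open Scope ring_scope.

(** Write [G = eta F], which is Lipschitz with constant [l = eta L], where
    (1 + sqrt 2) l < 1, and let y_t = 2 z_t - z_(t-1) be the reflected points.
    Since z_(t+1) is the projection of z_t - G(y_t), the vector
    c_(t+1) = z_t - G(y_t) - z_(t+1) is normal to Z at z_(t+1)
    ([eproj_normal]). Hence |F(z_T) + c_T / eta| bounds the tangent residual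
    ([tangent_residual_le]) and, after multiplication by D, the gap ([gap_le]),
    so it is enough to show that |G(z_T) + c_T|^2 = O(1/T).

    Two facts give this rate for the last iterate.

    - The potential P_t = |G(z_t) + c_t|^2 + |G(z_t) - G(y_(t-1))|^2 does not
      increase ([rg_potential_decr]). This combines the monotonicity of G + N
      between two successive iterates with the Lipschitz bound, in which the
      reflection makes z_(t+1) - y_t a difference of two successive steps.

    - The potentials are summable. P_t is at most
      2 (|z_t - z_(t-1)|^2 + |z_t - y_(t-1)|^2) ([rg_potential_le]), and these
      squared lengths are paid for, up to the factor 1 - (1 + sqrt 2) l, by the
      decrease of an energy made of the squared distance to the solution zs, a
      multiple of |z_t - y_(t-1)|^2 and the term 2 <G(zs), z_(t-1) - zs>
      ([rg_distance_step]); only |z_1 - y_0|^2 is left out, and it is at most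
      |G(z_0)|^2.

    Therefore T P_T is at most the sum of P_1, ..., P_T, which is bounded. The
    proof merges the two facts into a single Lyapunov function
    ([rg_lyapunov]) that contains t - 1 copies of P_t; its value after the first
    step is bounded in terms of |z_0 - zs| and |G(z_0)| ([rg_lyapunov_start]).
    The resulting constants are smaller than the ones claimed
    ([rate_constants]). *)

(** * Inner product and Euclidean norm *)

Lemma dotvC (R : realType) (n : nat) (u v : 'rV[R]_n) : dotv u v = dotv v u.
Proof. by apply: eq_bigr => i _; rewrite mulrC. Qed.

Lemma dotvDl (R : realType) (n : nat) (u v w : 'rV[R]_n) :
  dotv (u + v) w = dotv u w + dotv v w.
Proof. by rewrite -big_split; apply: eq_bigr => i _; rewrite mxE mulrDl. Qed.

Lemma dotvZl (R : realType) (n : nat) (k : R) (u w : 'rV[R]_n) :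
  dotv (k *: u) w = k * dotv u w.
Proof. by rewrite mulr_sumr; apply: eq_bigr => i _; rewrite mxE mulrA. Qed.

Lemma dotvNl (R : realType) (n : nat) (u w : 'rV[R]_n) :
  dotv (- u) w = - dotv u w.
Proof. by rewrite -scaleN1r dotvZl mulN1r. Qed.

Lemma dotvDr (R : realType) (n : nat) (u v w : 'rV[R]_n) :
  dotv w (u + v) = dotv w u + dotv w v.
Proof. by rewrite dotvC dotvDl !(dotvC w). Qed.

Lemma dotvZr (R : realType) (n : nat) (k : R) (u w : 'rV[R]_n) :
  dotv w (k *: u) = k * dotv w u.
Proof. by rewrite dotvC dotvZl (dotvC w). Qed.

Lemma dotvNr (R : realType) (n : nat) (u w : 'rV[R]_n) :
  dotv w (- u) = - dotv w u.
Proof. by rewrite dotvC dotvNl (dotvC w). Qed.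

Lemma dotvv_ge0 (R : realType) (n : nat) (u : 'rV[R]_n) : 0 <= dotv u u.
Proof. by apply: sumr_ge0 => i _; rewrite -expr2 sqr_ge0. Qed.

Definition dotvE := (dotvDl, dotvDr, dotvNl, dotvNr, dotvZl, dotvZr).

(** Expands every inner product bilinearly and orients each symmetric pair the
    same way, so that what remains is arithmetic in the entries of a Gram
    matrix. *)
Ltac gram_expand :=
  rewrite ?dotvE;
  repeat match goal with
  | |- context [dotv ?a ?b] =>
      match goal with
      | |- context [dotv b a] =>
          first [constr_eq a b; fail 1 | rewrite (dotvC b a)]
      end
  end.

Lemma l2norm_ge0 (R : realType) (n : nat) (u : 'rV[R]_n) : 0 <= l2norm u.
Proof. exact: sqrtr_ge0. Qed.

Lemma l2norm_sqr (R : realType) (n : nat) (u : 'rV[R]_n) :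
  l2norm u ^+ 2 = dotv u u.
Proof. by rewrite sqr_sqrtr ?dotvv_ge0. Qed.

Lemma ler_l2norm (R : realType) (n : nat) (u v : 'rV[R]_n) :
  (l2norm u <= l2norm v) = (dotv u u <= dotv v v).
Proof. by rewrite ler_sqrt ?dotvv_ge0. Qed.

(** Young's inequality in a division-free form: it is the nonnegativity of
    the squared norm of [u - k v]. *)
Lemma young_dotv (R : realType) (n : nat) (k : R) (u v : 'rV[R]_n) :
  2 * k * dotv u v <= dotv u u + k ^+ 2 * dotv v v.
Proof. by have := dotvv_ge0 (u - k *: v); gram_expand; lra. Qed.

(** The weight [k] of Young's inequality is chosen optimally, namely
    [k = dotv u v / l2norm v ^ 2]; for [v] of norm zero a large [k] gives a
    contradiction instead. *)
Lemma dotv_le (R : realType) (n : nat) (u v : 'rV[R]_n) :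
  dotv u v <= l2norm u * l2norm v.
Proof.
have young := fun k => young_dotv k u v; rewrite -!l2norm_sqr in young.
have := l2norm_ge0 u; have := l2norm_ge0 v; rewrite le_eqVlt.
move: (l2norm u) (l2norm v) (dotv u v) young => a b p young.
case/predU1P => [b0|b_gt0] a_ge0; rewrite leNgt; apply/negP => p_gt.
  subst b; rewrite mulr0 in p_gt.
  (* this weight makes the left-hand side equal to [2 * (a ^ 2 + 1)] *)
  have := young ((a ^+ 2 + 1) / p).
  rewrite -mulrA divfK ?gt_eqF // expr0n /= mulr0 addr0.
  have := sqr_ge0 a; lra.
have p_gt0 : 0 < p by apply: le_lt_trans p_gt; rewrite mulr_ge0 // ltW.
have := young (p / b ^+ 2).
have -> : 2 * (p / b ^+ 2) * p = 2 * (p ^+ 2 / b ^+ 2) by ring.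
have -> : (p / b ^+ 2) ^+ 2 * b ^+ 2 = p ^+ 2 / b ^+ 2.
  by field; rewrite gt_eqF.
have b2_gt0 : 0 < b ^+ 2 by rewrite exprn_gt0.
move=> h; have : p ^+ 2 / b ^+ 2 <= a ^+ 2 by lra.
rewrite ler_pdivrMr // -exprMn => p_le.
move: p_gt; rewrite ltNge; apply/negP/negPn.
by rewrite -(ler_pXn2r (ltn0Sn 1)) ?nnegrE ?mulr_ge0 // ltW.
Qed.

Lemma lipschitz_sqr (R : realType) (n : nat) (l : R)
    (G : 'rV[R]_n -> 'rV[R]_n) (u v : 'rV[R]_n) : 0 <= l -> l2_lipschitz l G ->
  dotv (G u - G v) (G u - G v) <= l ^+ 2 * dotv (u - v) (u - v).
Proof.
move=> l0 /(_ u v); rewrite -!l2norm_sqr -exprMn => h.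
by rewrite ler_pXn2r ?nnegrE ?mulr_ge0 ?l2norm_ge0.
Qed.

(** * Euclidean projection *)

Lemma continuous_sqdist (R : realType) (n : nat) (x : 'rV[R]_n) :
  continuous (fun p : 'rV[R]_n => dotv (x - p) (x - p)).
Proof.
pose f i (p : 'rV[R]_n) := (x - p) 0 i.
have cf i : continuous (f i).
  rewrite (_ : f i = (fun p : 'rV[R]_n => x 0 i - p 0 i)).
    move=> p; apply: continuousB; first exact: cst_continuous.
    exact: coord_continuous.
  by apply/funext => p; rewrite /f !mxE.
rewrite /dotv; elim: (index_enum _) => [|i s IHs].
  by under eq_fun do rewrite big_nil; exact: cst_continuous.
rewrite (_ : (fun p => _) =
    f i \* f i + fun p : 'rV[R]_n => \sum_(j <- s) (x - p) 0 j * (x - p) 0 j).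
  by move=> p; apply: continuousD; [apply: continuousM; exact: cf | exact: IHs].
by apply/funext => p; rewrite big_cons.
Qed.

(** Candidates at least as close to [x] as a chosen point [q] of [Z] have all
    their coordinates within [l2norm (x - q)] of those of [x], so they form a
    closed subset of a compact box and the distance attains its minimum. *)
Lemma eproj_minimal (R : realType) (n : nat) (Z : set 'rV[R]_n)
    (x : 'rV[R]_n) : Z !=set0 -> closed Z ->
  Z (eproj Z x) /\ forall z, Z z -> l2norm (x - eproj Z x) <= l2norm (x - z).
Proof.
move=> [q Zq] Zcl; rewrite /eproj; set P := [set p | _].
suff : exists p, P p by move=> /(xgetPex x).
pose f (p : 'rV[R]_n) := dotv (x - p) (x - p).
pose A := Z `&` f @^-1` [set r | r <= f q].
have Acl : closed A.
  apply: closedI => //; apply: (preimage_closed _ (@closed_le _ _)).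
  by move=> p _; exact: continuous_sqdist.
have Acompact : compact A.
  pose r := l2norm (x - q).
  have boxK : compact
      [set v : 'rV[R]_n | forall i, `[x 0 i - r, x 0 i + r]%classic (v 0 i)].
    apply: (@rV_compact _ _ (fun i => `[x 0 i - r, x 0 i + r]%classic)) => i.
    exact: segment_compact.
  apply: subclosed_compact Acl boxK _ => v [_ /= fv] i.
  rewrite in_itv /= -ler_distlC -(ler_pXn2r (ltn0Sn 1)) ?nnegrE ?l2norm_ge0 //.
  rewrite l2norm_sqr real_normK ?num_real //; apply: le_trans fv.
  rewrite /f /dotv (bigD1 i) //= !mxE -expr2 lerDl.
  by apply: sumr_ge0 => j _; rewrite -expr2 sqr_ge0.
have [||p pA pmin] := @EVT_min_rV R n f A _ Acompact.
- by exists q; split => //=.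
- by apply: continuous_subspaceT => p; exact: continuous_sqdist.
move: pA; rewrite inE => -[Zp /= fp]; exists p; split => // z Zz.
rewrite ler_l2norm -/(f p) -/(f z).
have [fz|/ltW fz] := leP (f z) (f q); last exact: le_trans fz.
by apply: pmin; rewrite inE.
Qed.

(** Along the segment from [p = eproj Z x] to a point [z] of [Z] the squared
    distance to [x] changes by [t * (t * m - 2 * b)], with
    [m = dotv (z - p) (z - p)] and [b = dotv (x - p) (z - p)]; for [b > 0] this
    is negative at small [t > 0]. *)
Lemma eproj_normal (R : realType) (n : nat) (Z : set 'rV[R]_n)
    (x : 'rV[R]_n) : Z !=set0 -> closed Z -> convex_set Z ->
  normal_cone Z (eproj Z x) (x - eproj Z x).
Proof.
move=> Z0 Zcl Zcvx z Zz; have [] := eproj_minimal x Z0 Zcl.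
move: (eproj Z x) => p Zp pmin.
set b := dotv _ _; set m := dotv (z - p) (z - p).
have m_ge0 : 0 <= m := dotvv_ge0 _.
have segment t : 0 <= t -> t <= 1 -> 0 <= t * (t * m - 2 * b).
  move=> t0 t1.
  have t01 : Itv.spec (@Itv.num_sem R) (Itv.Real `[0%Z, 1%Z]) t.
    by rewrite /Itv.spec /Itv.num_sem /= in_itv /= t0 t1 num_real.
  have := Zcvx z p (Itv.mk t01); rewrite !inE => /(_ Zz Zp) /pmin.
  rewrite /conv /= ler_l2norm /unstable.onem /b /m; gram_expand; lra.
rewrite leNgt; apply/negP => b_gt0.
(* [t = b / (m + b)] is at most 1 and makes [t * m < b], even for [m = 0] *)
have mb_gt0 : 0 < m + b by lra.
have t_le1 : b / (m + b) <= 1 by rewrite ler_pdivrMr //; lra.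
have t_gt0 : 0 < b / (m + b) by rewrite divr_gt0.
have := segment _ (ltW t_gt0) t_le1.
rewrite pmulr_rge0 // => h.
have : b / (m + b) * m < b by rewrite mulrAC ltr_pdivrMr // ltr_pM2l //; lra.
lra.
Qed.

(** * Monotonicity of the residual potential *)

(** When [z] is the projection of [zp - G yp], the vector [zp - G yp - z] is in
    the normal cone at [z], so this is an element of (G + N)(z). *)
Definition normal_residual (R : realType) (n : nat)
    (G : 'rV[R]_n -> 'rV[R]_n) (zp yp z : 'rV[R]_n) : 'rV[R]_n :=
  G z + (zp - G yp - z).

(** The second term is the squared error made by evaluating [G] at the
    reflected point instead of at the new iterate. Its value at one step helps
    to absorb its value at the next one, which is how the sum decreases. *)
Definition rg_potential (R : realType) (n : nat)
    (G : 'rV[R]_n -> 'rV[R]_n) (zp yp z : 'rV[R]_n) : R :=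
  dotv (normal_residual G zp yp z) (normal_residual G zp yp z) +
  dotv (G z - G yp) (G z - G yp).

(** Write [a] and [b] for the residuals at [z] and [w], and
    [p = G yp - G z], [q = G y - G w] with [y = 2 z - zp]. Then [z - w = b + q]
    and, as [G] plus the normal cone is monotone, <a - b, b + q> >= 0. Since
    |a|^2 + |p|^2 - |b|^2 - |q|^2 =
      2 <a - b, b + q> + |a - b - q|^2 + |p|^2 - 2 |q|^2,
    it remains to absorb |q|^2. The reflection gives [w - y = a - b - q + p],
    so the Lipschitz bound with [2 * l <= 1] yields
    4 |q|^2 <= |a - b - q + p|^2, and the parallelogram law concludes. *)
Lemma rg_potential_decr (R : realType) (n : nat) (Z : set 'rV[R]_n)
    (G : 'rV[R]_n -> 'rV[R]_n) (l : R) (zp yp z w : 'rV[R]_n) :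
  monotone_operator G -> l2_lipschitz l G -> 0 <= l -> 2 * l <= 1 ->
  Z z -> Z w ->
  normal_cone Z z (zp - G yp - z) ->
  normal_cone Z w (z - G (2 *: z - zp) - w) ->
  rg_potential G z (2 *: z - zp) w <= rg_potential G zp yp z.
Proof.
move=> Gmon Glip l0 l2 Zz Zw /(_ _ Zw) Nz /(_ _ Zz) Nw.
have mon := Gmon z w.
have lip : 4 * dotv (G w - G (2 *: z - zp)) (G w - G (2 *: z - zp)) <=
    dotv (w - (2 *: z - zp)) (w - (2 *: z - zp)).
  have := lipschitz_sqr w (2 *: z - zp) l0 Glip.
  have := dotvv_ge0 (w - (2 *: z - zp)).
  have : 0 <= (1 - 2 * l) * (1 + 2 * l) by apply: mulr_ge0; lra.
  set A := dotv _ _; set B := dotv _ _ => h A0 le.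
  have := mulr_ge0 h A0; lra.
(* the term |a - b - q - p|^2 discarded by the parallelogram law *)
have := dotvv_ge0 (normal_residual G zp yp z
  - normal_residual G z (2 *: z - zp) w - (G (2 *: z - zp) - G w)
  - (G yp - G z)).
rewrite /rg_potential /normal_residual.
move: mon lip Nz Nw; move: (G _) (G _) (G _) (G _) => Gz Gw Gy Gyp.
gram_expand; lra.
Qed.

(** The residual is [zp - z] minus the evaluation error [G yp - G z], and that
    error is at most [l2norm (z - yp) / 2]. *)
Lemma rg_potential_le (R : realType) (n : nat)
    (G : 'rV[R]_n -> 'rV[R]_n) (l : R) (zp yp z : 'rV[R]_n) :
  l2_lipschitz l G -> 0 <= l -> 2 * l <= 1 ->
  rg_potential G zp yp z <=
    2 * (dotv (z - zp) (z - zp) + dotv (z - yp) (z - yp)).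
Proof.
move=> Glip l0 l2.
have := lipschitz_sqr z yp l0 Glip.
have := dotvv_ge0 (z - yp).
have : 0 <= (1 - 2 * l) * (1 + 2 * l) by apply: mulr_ge0; lra.
have := dotvv_ge0 (zp - z - (G z - G yp)).
rewrite /rg_potential /normal_residual.
set A := dotv (z - yp) _ => sq h A0 le; have := mulr_ge0 h A0.
move: sq le; rewrite -/A; gram_expand; lra.
Qed.

(** * Decrease of the distance to the solution *)

(** Two weighted Young inequalities: the first, with weight [sqrt 2 * l],
    separates the increment of [G] from [y - w]; the second, with weight
    [1 + sqrt 2], splits [y - yp] at [z]. The total coefficient of
    [l2norm (y - z) ^ 2] is the [1 + sqrt 2] that limits the step size, and
    [(1 + sqrt 2) * (sqrt 2 - 1) = 1] leaves [l] on [z - yp]. *)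
Lemma reflection_error (R : realType) (n : nat) (l : R)
    (G : 'rV[R]_n -> 'rV[R]_n) (y yp z w : 'rV[R]_n) :
  l2_lipschitz l G -> 0 < l ->
  2 * dotv (G y - G yp) (y - w) <=
    (1 + Num.sqrt 2) * l * dotv (y - z) (y - z) + l * dotv (z - yp) (z - yp) +
    Num.sqrt 2 * l * dotv (w - y) (w - y).
Proof.
move=> Glip l0; set s := Num.sqrt 2.
have s2 : s ^+ 2 = 2 by rewrite sqr_sqrtr.
have s1 : 1 <= s by rewrite -sqrtr1 ler_sqrt //; lra.
have lip := lipschitz_sqr y yp (ltW l0) Glip.
have yw := young_dotv (s * l) (G y - G yp) (y - w).
have yz := young_dotv (1 + s) (z - yp) (y - z).
have -> : dotv (w - y) (w - y) = dotv (y - w) (y - w) by gram_expand; ring.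
have split : dotv (y - yp) (y - yp) = dotv (y - z) (y - z)
    + dotv (z - yp) (z - yp) + 2 * dotv (z - yp) (y - z).
  by gram_expand; ring.
move: lip yw yz; rewrite {}split.
move: (dotv (y - w) (y - w)) (dotv (G y - G yp) (y - w)).
move: (dotv (G y - G yp) _) (dotv (y - z) _).
move: (dotv (z - yp) (z - yp)) (dotv (z - yp) (y - z)).
move=> B C U A W D lip yw yz.
have s0 : 0 <= s - 1 by lra.
have C_le : 2 * C <= (1 + s) * A + (s - 1) * B.
  have : 0 <= (s - 1) * (B + (1 + s) ^+ 2 * A - 2 * (1 + s) * C).
    by apply: mulr_ge0 => //; lra.
  suff -> : (s - 1) * (B + (1 + s) ^+ 2 * A - 2 * (1 + s) * C) =
    (s ^+ 2 - 1) * (1 + s) * A + (s - 1) * B - 2 * (s ^+ 2 - 1) * C.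
    by rewrite s2; lra.
  by ring.
have : 0 <= l * (l * (A + B + 2 * C) + 2 * l * W - 2 * s * D).
  move: yw; rewrite exprMn s2; lra.
rewrite pmulr_rge0 // => D_le.
have lC : 2 * (l * C) <= (1 + s) * (l * A) + (s - 1) * (l * B).
  by have := ler_wpM2l (ltW l0) C_le; lra.
have : 0 <= s * (l * ((2 + s) * A + s * B) + 2 * l * W - 2 * s * D).
  by apply: mulr_ge0; lra.
suff -> : s * (l * ((2 + s) * A + s * B) + 2 * l * W - 2 * s * D) =
    (2 * s + s ^+ 2) * (l * A) + s ^+ 2 * (l * B) + 2 * s * (l * W)
    - 2 * s ^+ 2 * D by rewrite s2; lra.
by ring.
Qed.

(** The reflected point [y = 2 z - zp] is in general outside [Z], so
    dotv (G zs) (y - zs) may be negative. But it is affine in [y]: it is twice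
    its value at [z] minus its value at [zp], both nonnegative, so carrying
    such a value along in the estimate makes it telescope. The cross
    term dotv (G yp) (y - w) is handled by testing the normal vector at [z]
    against both [w] and [zp], since [y - w = (z - w) + (z - zp)]; what
    remains is the increment of [G] between the two reflected points. *)
Lemma rg_distance_step (R : realType) (n : nat) (Z : set 'rV[R]_n)
    (G : 'rV[R]_n -> 'rV[R]_n) (l : R) (zs zp yp z w : 'rV[R]_n) :
  monotone_operator G -> l2_lipschitz l G -> 0 < l ->
  VI_solution Z G zs ->
  Z zp -> Z z -> Z w ->
  normal_cone Z z (zp - G yp - z) ->
  normal_cone Z w (z - G (2 *: z - zp) - w) ->
  dotv (w - zs) (w - zs)
  + l * dotv (w - (2 *: z - zp)) (w - (2 *: z - zp))
  + 2 * dotv (G zs) (z - zs)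
  + (1 - (1 + Num.sqrt 2) * l) *
    (dotv (z - zp) (z - zp)
     + dotv (w - (2 *: z - zp)) (w - (2 *: z - zp))) <=
  dotv (z - zs) (z - zs) + l * dotv (z - yp) (z - yp)
  + 2 * dotv (G zs) (zp - zs).
Proof.
move=> Gmon Glip l0 [Zzs zsP] Zzp Zz Zw Nz Nw; set y := 2 *: z - zp.
have Nz1 := Nz _ Zzp; have {Nz}Nz2 := Nz _ Zw; have {Nw}Nw := Nw _ Zzs.
have {zsP}sol := zsP _ Zz.
have mon := Gmon y zs.
have err := reflection_error y yp z w Glip l0.
move: err mon sol Nz1 Nz2 Nw; rewrite /y; move: (G _) (G _) (G _) => Gy Gyp Gs.
have s0 := sqrtr_ge0 (2 : R); move: (Num.sqrt 2) s0 => s s0.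
gram_expand; lra.
Qed.

(** * The Lyapunov function *)

Definition rg_energy (R : realType) (n : nat) (G : 'rV[R]_n -> 'rV[R]_n)
    (l : R) (zs zp yp z : 'rV[R]_n) : R :=
  dotv (z - zs) (z - zs) + l * dotv (z - yp) (z - yp)
  + 2 * dotv (G zs) (zp - zs).

(** The summability of the residual potentials and their monotonicity are
    merged into one decreasing quantity, so that no sum over the iterations has
    to be written: [t] copies of the current potential stand for the sum of the
    previous ones. The term in [z - yp] pays for the part of the next potential
    that the distance step at the same index does not cover. *)
Definition rg_lyapunov (R : realType) (n : nat) (G : 'rV[R]_n -> 'rV[R]_n)
    (l : R) (zs : 'rV[R]_n) (t : nat) (zp yp z : 'rV[R]_n) : R :=
  2 * rg_energy G l zs zp yp z
  + (1 - (1 + Num.sqrt 2) * l) *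
    (2 * dotv (z - yp) (z - yp) + t%:R * rg_potential G zp yp z).

Lemma small_step_half (R : realType) (l : R) :
  0 <= l -> (1 + Num.sqrt 2) * l < 1 -> 2 * l <= 1.
Proof.
move=> l0 k0.
have s1 : 0 <= Num.sqrt 2 - 1 :> R.
  by rewrite subr_ge0 -[leLHS]sqrtr1 ler_sqrt //; lra.
by have := mulr_ge0 s1 l0; lra.
Qed.

Lemma rg_energy_ge0 (R : realType) (n : nat) (Z : set 'rV[R]_n)
    (G : 'rV[R]_n -> 'rV[R]_n) (l : R) (zs zp yp z : 'rV[R]_n) :
  VI_solution Z G zs -> 0 <= l -> Z zp -> 0 <= rg_energy G l zs zp yp z.
Proof.
move=> [_ /(_ zp) sol] l0 /sol{}sol.
have := mulr_ge0 l0 (dotvv_ge0 (z - yp)).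
have := dotvv_ge0 (z - zs); rewrite /rg_energy.
have : dotv (G zs) (zp - zs) = - dotv (G zs) (zs - zp) by gram_expand; ring.
lra.
Qed.

(** The distance step releases the lengths of [z - zp] and of [w - y]; the
    former, with the term in [z - yp], covers one more copy of the potential.
    This form, in which the counter has moved on but the potential
    is still the old one, serves twice: monotonicity of the potential turns it
    into the decrease of the Lyapunov function, and discarding the other terms
    bounds [t.+1] times the potential. *)
Lemma rg_lyapunov_drop (R : realType) (n : nat) (Z : set 'rV[R]_n)
    (G : 'rV[R]_n -> 'rV[R]_n) (l : R) (zs : 'rV[R]_n) (t : nat)
    (zp yp z w : 'rV[R]_n) :
  monotone_operator G -> l2_lipschitz l G -> 0 < l ->
  (1 + Num.sqrt 2) * l < 1 -> VI_solution Z G zs ->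
  Z zp -> Z z -> Z w ->
  normal_cone Z z (zp - G yp - z) ->
  normal_cone Z w (z - G (2 *: z - zp) - w) ->
  2 * rg_energy G l zs z (2 *: z - zp) w
  + (1 - (1 + Num.sqrt 2) * l) *
    (2 * dotv (w - (2 *: z - zp)) (w - (2 *: z - zp))
     + t.+1%:R * rg_potential G zp yp z)
  <= rg_lyapunov G l zs t zp yp z.
Proof.
move=> Gmon Glip l0 k0 sol Zzp Zz Zw Nz Nw.
have l2 := small_step_half (ltW l0) k0.
have := rg_distance_step Gmon Glip l0 sol Zzp Zz Zw Nz Nw.
have := rg_potential_le zp yp z Glip (ltW l0) l2.
rewrite /rg_lyapunov /rg_energy -(natr1 t).
set y := 2 *: z - zp; set k := 1 - _.
have {}k0 : 0 <= k by rewrite /k; lra.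
move: (rg_potential _ _ _ _) => P P_le step; have := ler_wpM2l k0 P_le.
clearbody k; lra.
Qed.

Lemma rg_lyapunov_decr (R : realType) (n : nat) (Z : set 'rV[R]_n)
    (G : 'rV[R]_n -> 'rV[R]_n) (l : R) (zs : 'rV[R]_n) (t : nat)
    (zp yp z w : 'rV[R]_n) :
  monotone_operator G -> l2_lipschitz l G -> 0 < l ->
  (1 + Num.sqrt 2) * l < 1 -> VI_solution Z G zs ->
  Z zp -> Z z -> Z w ->
  normal_cone Z z (zp - G yp - z) ->
  normal_cone Z w (z - G (2 *: z - zp) - w) ->
  rg_lyapunov G l zs t.+1 z (2 *: z - zp) w <= rg_lyapunov G l zs t zp yp z.
Proof.
move=> Gmon Glip l0 k0 sol Zzp Zz Zw Nz Nw.
have l2 := small_step_half (ltW l0) k0.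
have drop := rg_lyapunov_drop t Gmon Glip l0 k0 sol Zzp Zz Zw Nz Nw.
have decr := rg_potential_decr Gmon Glip (ltW l0) l2 Zz Zw Nz Nw.
apply: (le_trans _ drop).
have {}k0 : 0 <= 1 - (1 + Num.sqrt 2) * l by lra.
have := ler_wpM2l k0 (ler_wpM2l (ler0n R t.+1) decr).
rewrite /rg_lyapunov; lra.
Qed.

(** The first step is an ordinary projected step of length at most
    [l2norm (G z0)], so all terms are controlled by the distance to the solution
    and by [G z0]. *)
Lemma rg_lyapunov_start (R : realType) (n : nat) (Z : set 'rV[R]_n)
    (G : 'rV[R]_n -> 'rV[R]_n) (l : R) (zs z0 z1 : 'rV[R]_n) :
  monotone_operator G -> 0 < l -> (1 + Num.sqrt 2) * l < 1 ->
  Z z0 -> normal_cone Z z1 (z0 - G z0 - z1) ->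
  rg_lyapunov G l zs 0 z0 z0 z1 <=
    6 * dotv (z0 - zs) (z0 - zs) + 10 * dotv (G z0) (G z0).
Proof.
move=> Gmon l0 k0 Zz0 Nz1.
have s0 : 0 <= Num.sqrt 2 :> R := sqrtr_ge0 _.
have l1 : l <= 1 by have := mulr_ge0 s0 (ltW l0); lra.
set g := dotv (G z0) (G z0).
have g0 : 0 <= g := dotvv_ge0 _.
have step_le : dotv (z1 - z0) (z1 - z0) <= g.
  have := Nz1 _ Zz0; have := young_dotv 1 (G z0) (z0 - z1).
  by rewrite /g; gram_expand; lra.
have dist_le : dotv (z1 - zs) (z1 - zs) <=
    2 * dotv (z0 - zs) (z0 - zs) + 2 * dotv (z1 - z0) (z1 - z0).
  by have := young_dotv 1 (z0 - zs) (z1 - z0); gram_expand; lra.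
have slope_le : 2 * dotv (G zs) (z0 - zs) <= dotv (z0 - zs) (z0 - zs) + g.
  have := Gmon z0 zs; have := young_dotv 1 (G z0) (z0 - zs).
  by rewrite /g; gram_expand; lra.
rewrite /rg_lyapunov /rg_energy mul0r addr0.
have := dotvv_ge0 (z1 - z0).
move: step_le dist_le slope_le; move: (dotv (z1 - z0) _) (dotv (z1 - zs) _).
move: (dotv (z0 - zs) _) (dotv (G zs) _) => A B C D CA DA BA C0.
have lC : (l + (1 - (1 + Num.sqrt 2) * l)) * C <= C.
  by have := mulr_ge0 (mulr_ge0 s0 (ltW l0)) C0; lra.
have lC' : l * C <= C by have := ler_wpM2r C0 l1; lra.
lra.
Qed.

(** The hypotheses on [z] are the optimality conditions of the projections.
    With [0.-1 = 0] the reflected point at index 0 is [z 0],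
    which encodes the convention that the iterate before the first one equals
    it. *)
Lemma rg_potential_rate (R : realType) (n : nat) (Z : set 'rV[R]_n)
    (G : 'rV[R]_n -> 'rV[R]_n) (l : R) (zs : 'rV[R]_n) (z : nat -> 'rV[R]_n)
    (t : nat) :
  monotone_operator G -> l2_lipschitz l G -> 0 < l ->
  (1 + Num.sqrt 2) * l < 1 -> VI_solution Z G zs ->
  (forall i, Z (z i)) ->
  (forall i, normal_cone Z (z i.+1)
    (z i - G (2 *: z i - z i.-1) - z i.+1)) ->
  (1 - (1 + Num.sqrt 2) * l) *
    (t.+1%:R * rg_potential G (z t) (2 *: z t - z t.-1) (z t.+1)) <=
  6 * dotv (z 0 - zs) (z 0 - zs) + 10 * dotv (G (z 0)) (G (z 0)).
Proof.
move=> Gmon Glip l0 k0 sol Zz Nz.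
have lyap : rg_lyapunov G l zs t (z t) (2 *: z t - z t.-1) (z t.+1) <=
    6 * dotv (z 0 - zs) (z 0 - zs) + 10 * dotv (G (z 0)) (G (z 0)).
  elim: t => [|t IHt].
    have := Nz 0; have -> : 2 *: z 0 - z 0.-1 = z 0.
      by rewrite scaler_nat mulr2n addrK.
    exact: rg_lyapunov_start Gmon l0 k0 (Zz 0).
  apply: (le_trans _ IHt).
  exact: (rg_lyapunov_decr t Gmon Glip l0 k0 sol (Zz t) (Zz t.+1) (Zz t.+2)
    (Nz t) (Nz t.+1)).
have drop := rg_lyapunov_drop t Gmon Glip l0 k0 sol (Zz t) (Zz t.+1) (Zz t.+2)
  (Nz t) (Nz t.+1).
have E_ge0 := rg_energy_ge0 (2 *: z t.+1 - z t) (z t.+2) sol (ltW l0)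
  (Zz t.+1).
have k_ge0 : 0 <= 1 - (1 + Num.sqrt 2) * l by lra.
have := mulr_ge0 k_ge0 (dotvv_ge0 (z t.+2 - (2 *: z t.+1 - z t))).
lra.
Qed.

(** * Back to the algorithm *)

Lemma reflected_gradientS (R : realType) (n : nat) (Z : set 'rV[R]_n)
    (F : 'rV[R]_n -> 'rV[R]_n) (eta : R) (z0 : 'rV[R]_n) (t : nat) :
  let z := reflected_gradient Z F eta z0 in
  z t.+1 = eproj Z (z t - eta *: F (2 *: z t - z t.-1)).
Proof.
have fst_iter : (iter t (rg_step Z F eta) (z0, z0)).1 =
    reflected_gradient Z F eta z0 t.-1 by case: t.
by rewrite /= -fst_iter.
Qed.

(** * Tangent residual, gap and rate *)

Lemma tangent_residual_le (R : realType) (n : nat) (Z : set 'rV[R]_n)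
    (F : 'rV[R]_n -> 'rV[R]_n) (z c : 'rV[R]_n) :
  normal_cone Z z c -> tangent_residual F Z z <= l2norm (F z + c).
Proof.
move=> Nc; apply: ge_inf; last by exists c.
by exists 0 => _ [a _ <-]; exact: l2norm_ge0.
Qed.

(** A normal vector at [z] has a nonnegative inner product with [z - z'], so
    adding it to [F z] can only increase the linear form; Cauchy-Schwarz
    concludes. *)
Lemma gap_le (R : realType) (n : nat) (Z : set 'rV[R]_n)
    (F : 'rV[R]_n -> 'rV[R]_n) (D : R) (z c : 'rV[R]_n) :
  Z z -> 0 <= D -> normal_cone Z z c ->
  gap Z F D z <= l2norm (F z + c) * D.
Proof.
move=> Zz D0 Nc; apply: ge_sup.
  exists (dotv (F z) (z - z)), z => //; split=> //.
  rewrite /l2_closed_ball /= subrr /l2norm /dotv big1 ?sqrtr0 // => i _.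
  by rewrite mxE mul0r.
move=> _ [z' [Zz' z'D] <-].
have le_c : dotv (F z) (z - z') <= dotv (F z + c) (z - z').
  by have := Nc _ Zz'; gram_expand; lra.
apply: le_trans le_c (le_trans (dotv_le _ _) _).
apply: ler_wpM2l; first exact: l2norm_ge0.
suff -> : l2norm (z - z') = l2norm (z' - z) by [].
by congr Num.sqrt; gram_expand; ring.
Qed.

(** The constants of the analysis, 6 and 10, are well below those in [H] and
    [lambda]; the comparison rests on [eta * L <= 1], which makes
    [eta ^ 2 <= 1 / L ^ 2]. *)
Lemma rate_constants (R : realType) (L eta N r f d : R) :
  0 < L -> 0 < eta -> (1 + Num.sqrt 2) * (eta * L) < 1 -> 0 < N -> 0 <= r ->
  (1 - (1 + Num.sqrt 2) * (eta * L)) * (N * (eta ^+ 2 * r ^+ 2)) <=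
    6 * d ^+ 2 + 10 * (eta ^+ 2 * f ^+ 2) ->
  r <= Num.sqrt (6 * (1 + 3 * eta ^+ 2 * L ^+ 2) /
      (eta ^+ 2 * L ^+ 2 * (1 - (1 + Num.sqrt 2) * eta * L))) *
    Num.sqrt (4 * d ^+ 2 + 13 / L ^+ 2 * f ^+ 2) * L / Num.sqrt N.
Proof.
move=> L0 eta0 k_lt1 N0 r0; rewrite -[_ * eta * L]mulrA.
have k0 : 0 < 1 - (1 + Num.sqrt 2) * (eta * L) by rewrite subr_gt0.
have s0 : 0 <= Num.sqrt 2 :> R := sqrtr_ge0 _.
have l0 : 0 < eta * L by exact: mulr_gt0.
have l1 : eta ^+ 2 * L ^+ 2 <= 1.
  rewrite -exprMn expr_le1 ?ltW //.
  by have := mulr_ge0 s0 (ltW l0); lra.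
move: (1 - _) k0 => k k0 rate; clear k_lt1 s0.
have [d2 f2 e2 r2] : [/\ 0 <= d ^+ 2, 0 <= f ^+ 2, 0 < eta ^+ 2 & 0 <= r ^+ 2].
  by rewrite !sqr_ge0 exprn_gt0.
have L2 : 0 < L ^+ 2 by rewrite exprn_gt0.
have l2 : 0 < eta ^+ 2 * L ^+ 2 by rewrite mulr_gt0.
rewrite -(ler_pXn2r (ltn0Sn 1)) ?nnegrE //; last first.
  by rewrite !mulr_ge0 ?invr_ge0 ?sqrtr_ge0 ?ltW.
have -> : 4 * d ^+ 2 + 13 / L ^+ 2 * f ^+ 2 =
    (4 * (L ^+ 2 * d ^+ 2) + 13 * f ^+ 2) / L ^+ 2.
  by field; rewrite gt_eqF.
rewrite expr_div_n !exprMn !sqr_sqrtr ?(ltW N0) //; last 2 first.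
- rewrite divr_ge0 ?(ltW L2) //; have := mulr_ge0 (ltW L2) d2; lra.
- by rewrite divr_ge0 ?(ltW (mulr_gt0 l2 k0)) //; lra.
rewrite ler_pdivlMr //.
move: (d ^+ 2) (f ^+ 2) (eta ^+ 2) (r ^+ 2) (L ^+ 2) d2 f2 e2 r2 L2 l1 l2 rate.
move=> {d f r r0 eta eta0 L L0 l0} d f e r L d0 f0 e0 r0 L0 l1 l0 rate.
have -> : 6 * (1 + 3 * e * L) / (e * L * k) * ((4 * (L * d) + 13 * f) / L) * L
    = 6 * (1 + 3 * (e * L)) * (4 * (L * d) + 13 * f) / (e * L * k).
  by field; rewrite !gt_eqF.
rewrite ler_pdivlMr; last by rewrite mulr_gt0.
have rate_L := ler_wpM2l (ltW L0) rate.
have Ld0 := mulr_ge0 (ltW L0) d0.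
have lf := ler_wpM2r f0 l1.
have slack : 0 <= e * L * (4 * (L * d) + 13 * f).
  by apply: mulr_ge0; [exact: ltW | lra].
lra.
Qed.

Theorem theorem3 (R : realType) (n : nat) (Z : set 'rV[R]_n)
  (F : 'rV[R]_n -> 'rV[R]_n) (L : R) (zs z0 : 'rV[R]_n) (eta : R)
  (Z_nonempty : Z !=set0) (Z_closed : closed Z) (Z_convex : convex_set Z)
  (F_monotone : monotone_operator F)
  (L_gt0 : 0 < L) (F_lipschitz : l2_lipschitz L F)
  (zs_solution : VI_solution Z F zs)
  (eta_gt0 : 0 < eta) (eta_lt : eta < 1 / ((1 + Num.sqrt 2) * L))
  (Z_z0 : Z z0) :
  let z := reflected_gradient Z F eta z0 in
  let H := Num.sqrt (4 * l2norm (z0 - zs) ^+ 2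
                     + 13 / L ^+ 2 * l2norm (F z0) ^+ 2) in
  let lambda := Num.sqrt (6 * (1 + 3 * eta ^+ 2 * L ^+ 2) /
    (eta ^+ 2 * L ^+ 2 * (1 - (1 + Num.sqrt 2) * eta * L))) in
  forall (T : nat) (D : R), (1 <= T)%N -> 0 < D ->
    tangent_residual F Z (z T) <= lambda * H * L / Num.sqrt T%:R /\
    gap Z F D (z T) <= lambda * D * H * L / Num.sqrt T%:R.
Proof.
move=> z H lambda T D T1 D0.
have s0 : 0 <= Num.sqrt 2 :> R := sqrtr_ge0 _.
have k0 : (1 + Num.sqrt 2) * (eta * L) < 1.
  move: eta_lt; rewrite ltr_pdivlMr; last by rewrite mulr_gt0 //; lra.
  by lra.
(* absorb the step size: the algorithm is then run with unit step on [G] *)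
pose l := eta * L; pose G (x : 'rV[R]_n) := eta *: F x.
have l_gt0 : 0 < l by exact: mulr_gt0.
have Gmon : monotone_operator G.
  by move=> u v; rewrite -scalerBr dotvZl mulr_ge0 // ltW.
have Glip : l2_lipschitz l G.
  move=> u v; rewrite -scalerBr -mulrA /l2norm dotvZl dotvZr mulrA -expr2.
  rewrite sqrtrM ?sqr_ge0 // sqrtr_sqr gtr0_norm // ler_pM2l //.
  exact: F_lipschitz.
have Gsol : VI_solution Z G zs.
  case: zs_solution => Zzs sol; split=> // v Zv.
  by rewrite dotvZl pmulr_rle0 //; exact: sol.
have Zz i : Z (z i).
  case: i => [//|i]; rewrite /z reflected_gradientS.
  by case: (eproj_minimal (z i - G (2 *: z i - z i.-1)) Z_nonempty Z_closed).
have Nz i : normal_cone Z (z i.+1) (z i - G (2 *: z i - z i.-1) - z i.+1).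
  by rewrite {1 5}/z reflected_gradientS; exact: eproj_normal.
case: T T1 => // t _.
have rate := rg_potential_rate t Gmon Glip l_gt0 k0 Gsol Zz Nz.
set w := z t.+1; set y := 2 *: z t - z t.-1 in rate.
pose c := eta^-1 *: (z t - G y - w).
have Nc : normal_cone Z w c.
  by move=> v Zv; rewrite dotvZl pmulr_rle0 ?invr_gt0 //; exact: Nz.
(* the bound on one element of (F + N)(z_T) controls both quantities *)
suff res : l2norm (F w + c) <= lambda * H * L / Num.sqrt t.+1%:R.
  split; first exact: le_trans (tangent_residual_le F Nc) res.
  apply: le_trans (gap_le F (Zz _) (ltW D0) Nc) _.
  have -> : lambda * D * H * L / Num.sqrt t.+1%:R =
      lambda * H * L / Num.sqrt t.+1%:R * D by ring.
  by apply: ler_wpM2r => //; exact: ltW.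
have res_scaled : normal_residual G (z t) y w = eta *: (F w + c).
  by rewrite scalerDr scalerA mulfV ?gt_eqF // scale1r.
have {rate} : (1 - (1 + Num.sqrt 2) * l) *
    (t.+1%:R * (eta ^+ 2 * l2norm (F w + c) ^+ 2)) <=
    6 * l2norm (z0 - zs) ^+ 2 + 10 * (eta ^+ 2 * l2norm (F z0) ^+ 2).
  rewrite !l2norm_sqr; move: rate.
  rewrite /rg_potential res_scaled /G -/w -[z 0]/z0.
  rewrite !dotvZl !dotvZr.
  have k_ge0 : 0 <= 1 - (1 + Num.sqrt 2) * l by rewrite subr_ge0 ltW.
  have := mulr_ge0 k_ge0 (mulr_ge0 (ler0n R t.+1)
    (dotvv_ge0 (eta *: F w - eta *: F y))).
  lra.
by apply: rate_constants => //; exact: l2norm_ge0.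
Qed.
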